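(* Let $H$ be a complex Hilbert space and let $T\in B(H)$ be a normal operator that is not selfadjoint. The following are equivalent: (i) $\mathcal S(T,T^* )$ is an SI semigroup. (ii) $T$ is unitarily equivalent to $U\oplus 0$ (or to $U$ when $\ker T=\{0\}$) with $U$ a unitary operator. (iii) $\mathcal S(T,T^* )$ is a simple semigroup.
   Context: $H$ may be finite or infinite dimensional; $B(H)$ is the set of bounded linear operators on $H$. A semigroup $\mathcal S\subset B(H)$ is a subset closed under multiplication. $\mathcal S(T,T^* )$ is the semigroup generated by $\{T,T^*\}$, i.e. the set of all finite nonempty words in $T$ and $T^*$. An ideal $J$ of a semigroup $\mathcal S$ is a (two-sided) multiplicative ideal: a subset $J\subset\mathcal S$ with $XA, AX\in J$ for all $A\in J$, $X\in\mathcal S$ (no closure under sums or scalars is required). $\mathcal S$ is a selfadjoint-ideal (SI) semigroup if every ideal $J$ of $\mathcal S$ satisfies $\{A^*: A\in J\}\subset J$. $\mathcal S$ is simple if its only nonzero ideal (i.e. ideal containing a nonzero operator) is $\mathcal S$ itself; $\mathcal S$ may or may not contain $0$. *)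

(* Defs.v *)
From HB Require Import structures.
From mathcomp Require Import all_boot all_order all_algebra.
From mathcomp Require Import complex ring.
From mathcomp Require Import boolp classical_sets reals topology normedtype.

Set Implicit Arguments.
Unset Strict Implicit.
Unset Printing Implicit Defensive.

Import Order.TTheory GRing.Theory Num.Theory.
Import numFieldNormedType.Exports.

Local Open Scope classical_set_scope.
Local Open Scope complex_scope.
Local Open Scope ring_scope.

Section DotNorm.
Variables (C : numClosedFieldType) (V : lmodType C).
Variable form : {dot V for (@Num.conj C)}.

Local Notation "''[' u , v ]" := (form u v) : ring_scope.
Local Notation "''[' u ]" := '[u, u] : ring_scope.

Lemma dot_sym u v : '[u, v] = ('[v, u])^*.
Proof. by rewrite hermC expr0 mul1r. Qed.

Lemma dot_CauchySchwarz u v : `|'[u, v]| ^+ 2 <= '[u] * '[v].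
Proof.
have [->|v0] := eqVneq v 0; first by rewrite !linear0r normr0 expr0n mulr0.
have vv0 : 0 < '[v] by rewrite dnorm_gt0.
pose a := '[u, v] / '[v].
have ha : a^* = '[v, u] / '[v].
  by rewrite rmorphM /= fmorphV /= -!dot_sym.
have : 0 <= '[u - a *: v] by [].
rewrite dnormB dnormZ linearZr_LR /= ha.
have -> : '[v, u] / '[v] * '[u, v] = `|'[u, v]| ^+ 2 / '[v].
  by rewrite normCK -dot_sym mulrAC ['[v, u] * _]mulrC.
have -> : `|a| ^+ 2 * '[v] = `|'[u, v]| ^+ 2 / '[v].
  rewrite /a normrM exprMn normfV (ger0_norm (ltW vv0)).
  by rewrite -mulrA; congr (_ * _); rewrite expr2 -mulrA mulVf ?mulr1 ?gt_eqF.
have -> : (`|'[u, v]| ^+ 2 / '[v])^* = `|'[u, v]| ^+ 2 / '[v].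
  by rewrite geC0_conj// divr_ge0// ?exprn_ge0// ltW.
by rewrite opprD addrA addrK subr_ge0 ler_pdivrMr.
Qed.

Definition dot_norm (u : V) : C := sqrtC '[u].

Lemma dot_normD u v : dot_norm (u + v) <= dot_norm u + dot_norm v.
Proof.
have h0 w : 0 <= dot_norm w by rewrite sqrtC_ge0.
rewrite -(@ler_pXn2r _ 2) ?nnegrE ?addr_ge0//.
rewrite sqrrD !sqrtCK dnormD [leRHS]addrAC lerD2l.
have le1 : `|'[u, v]| <= dot_norm u * dot_norm v.
  rewrite -(@ler_pXn2r _ 2) ?nnegrE ?mulr_ge0// exprMn !sqrtCK.
  exact: dot_CauchySchwarz.
have hRe : '[u, v] + '[u, v]^* = 'Re '[u, v] *+ 2.
  by rewrite ReE -mulr_natr mulfVK// pnatr_eq0.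
rewrite hRe lerMn2r/= (le_trans _ le1)//.
by rewrite leif_Re_Creal.
Qed.

Lemma dot_normZ a u : dot_norm (a *: u) = `|a| * dot_norm u.
Proof.
by rewrite /dot_norm dnormZ sqrtCM ?nnegrE ?exprn_ge0// sqrCK.
Qed.

Lemma dot_norm_eq0 u : dot_norm u = 0 -> u = 0.
Proof. by move=> /eqP; rewrite sqrt_dnorm_eq0 => /eqP. Qed.

End DotNorm.

(* Inner products are linear in the first argument and conjugate-linear in the
   second one. *)
HB.mixin Record NormedModule_hasInner (R : realType) H
    & NormedModule R[i] H := {
  inner : {dot H for (@Num.conj R[i])} ;
  inner_norm : forall x : H, inner x x = `|x| ^+ 2
}.

#[short(type="preHilbertType")]
HB.structure Definition PreHilbert (R : realType) :=
  {H of NormedModule R[i] H & NormedModule_hasInner R H}.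

#[short(type="hilbertType")]
HB.structure Definition Hilbert (R : realType) :=
  {H of CompleteNormedModule R[i] H & NormedModule_hasInner R H}.

HB.factory Record Lmodule_hasInner (R : realType) H & GRing.Lmodule R[i] H := {
  inner : {dot H for (@Num.conj R[i])}
}.

HB.builders Context R H & Lmodule_hasInner R H.

HB.instance Definition _ := @Lmodule_isNormed.Build R[i] H (dot_norm inner)
  (dot_normD inner) (dot_normZ inner) (@dot_norm_eq0 _ _ inner).

Let inner_norm (x : H) : inner x x = `|x| ^+ 2.
Proof. by rewrite [in RHS]/Num.norm/= sqrtCK. Qed.

HB.instance Definition _ := NormedModule_hasInner.Build R H inner_norm.

HB.end.


(* The orthogonal direct sum. It is an alias of the product because the norm
   that the library puts on a product is the maximum of the two norms. *)
Definition hsum (R : realType) (K L : hilbertType R) : Type := (K * L)%type.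

Section HilbertSum.
Variables (R : realType) (K L : hilbertType R).
Local Notation KL := (hsum K L).

HB.instance Definition _ := GRing.Lmodule.copy KL (K * L)%type.

Definition hsum_inner (u v : KL) : R[i] := inner u.1 v.1 + inner u.2 v.2.

Let hsum_bilinear : bilinear_for *%R (@Num.conj R[i] \; *%R) hsum_inner.
Proof.
split=> [w a u v|w a u v]; rewrite /hsum_inner /=.
  by rewrite !linearDl /= !linearZl_LR /= mulrDr addrACA.
by rewrite !linearDr /= !linearZr_LR /= mulrDr addrACA.
Qed.

Let hsum_hermitian (u v : KL) :
  hsum_inner u v = (-1) ^+ false * (hsum_inner v u)^*.
Proof.
by rewrite /hsum_inner expr0 mul1r rmorphD /= -!dot_sym.
Qed.

Let hsum_gt0 (u : KL) : u != 0 -> 0 < hsum_inner u u.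
Proof.
move=> u0; rewrite /hsum_inner lt_def addr_ge0// andbT.
rewrite paddr_eq0// !dnorm_eq0; apply: contra u0 => /andP[/eqP u1 /eqP u2].
by apply/eqP; case: u u1 u2 => /= ? ? -> ->.
Qed.

HB.instance Definition _ := @bilinear_isBilinear.Build R[i] KL KL R[i]
  *%R (@Num.conj R[i] \; *%R) hsum_inner hsum_bilinear.
HB.instance Definition _ := @isHermitianSesquilinear.Build R[i] KL false
  (@Num.conj R[i]) hsum_inner hsum_hermitian.
HB.instance Definition _ := @isDotProduct.Build R[i] KL hsum_inner hsum_gt0.

HB.instance Definition _ := @Lmodule_hasInner.Build R KL hsum_inner.

Lemma hsum_normE (u : KL) : `|u| ^+ 2 = `|u.1| ^+ 2 + `|u.2| ^+ 2.
Proof. by rewrite -!inner_norm. Qed.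

Lemma hsum_norm1 (u : KL) : `|u.1| <= `|u|.
Proof.
by rewrite -(@ler_pXn2r _ 2) ?nnegrE// hsum_normE lerDl exprn_ge0.
Qed.

Lemma hsum_norm2 (u : KL) : `|u.2| <= `|u|.
Proof.
by rewrite -(@ler_pXn2r _ 2) ?nnegrE// hsum_normE lerDr exprn_ge0.
Qed.

Lemma hsum_normD (u : KL) : `|u| <= `|u.1| + `|u.2|.
Proof.
rewrite -(@ler_pXn2r _ 2) ?nnegrE ?addr_ge0// hsum_normE sqrrD.
by rewrite addrAC lerDl mulrn_wge0// mulr_ge0.
Qed.

Let hsum_complete (F : set_system KL) : ProperFilter F -> cauchy F -> cvg F.
Proof.
move=> FF /cauchy_ballP Fc.
have proj (E : hilbertType R) (p : KL -> E) :
    (forall u v, `|p u - p v| <= `|u - v|) -> cvg (p @ F).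
  move=> pE; apply: cauchy_cvg; apply/cauchy_ballP => e e0.
  have := Fc e e0; rewrite /= => -[[A B]] /= [FA FB] AB.
  exists ([set p x | x in A], [set p x | x in B]) => /=.
    split; rewrite /nbhs/=.
      by apply: filterS FA => x Ax; exists x.
    by apply: filterS FB => x Bx; exists x.
  move=> [_ _] /= [[x Ax <-] [y By <-]].
  have := AB (x, y) (conj Ax By).
  by rewrite -!ball_normE /=; apply: le_lt_trans.
have /cvg_ex[/= a Fa] : cvg (fst @ F).
  by apply: (proj K (fun u : KL => u.1)) => u v; exact: (hsum_norm1 (u - v)).
have /cvg_ex[/= b Fb] : cvg (snd @ F).
  by apply: (proj L (fun u : KL => u.2)) => u v; exact: (hsum_norm2 (u - v)).
apply/cvg_ex; exists ((a, b) : KL); apply/cvgrPdist_lt => e e0.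
have e20 : 0 < e / 2 by rewrite divr_gt0.
move/cvgrPdist_lt: Fa => /(_ _ e20) Fa.
move/cvgrPdist_lt: Fb => /(_ _ e20) Fb.
near=> u.
rewrite (le_lt_trans (hsum_normD _))// (splitr e) ltrD//=.
  by near: u.
by near: u.
Unshelve. all: by end_near. Qed.

HB.instance Definition _ := Uniform_isComplete.Build KL hsum_complete.

End HilbertSum.


Section Riesz.
Variables (R : realType) (H : hilbertType R).

Lemma inner_CauchySchwarz (x y : H) : `|inner x y| <= `|x| * `|y|.
Proof.
rewrite -(@ler_pXn2r _ 2) ?nnegrE ?mulr_ge0// exprMn -!inner_norm.
exact: dot_CauchySchwarz.
Qed.

Lemma inner_inj (y z : H) : (forall x, inner x y = inner x z) -> y = z.
Proof.
move=> yz; apply/eqP; rewrite -subr_eq0 -(@dnorm_eq0 _ _ inner) linearBr /=.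
by rewrite yz subrr.
Qed.

Lemma parallelogram (x y : H) :
  `|x - y| ^+ 2 = `|x| ^+ 2 *+ 2 + `|y| ^+ 2 *+ 2 - `|x + y| ^+ 2.
Proof.
rewrite -!inner_norm dnormB dnormD.
by rewrite !mulr2n !opprD !addrA; ring.
Qed.

Let infC (A : set R[i]) : A !=set0 -> (forall a, A a -> 0 <= a) ->
  exists d, (forall a, A a -> d <= a) /\
            (forall e, 0 < e -> exists2 a, A a & a < d + e).
Proof.
move=> [a0 Aa0] A0.
have AE a : A a -> a = (complex.Re a)%:C.
  by move=> /A0 /ger0_Im; case: a => ? ? /= ->.
pose B := [set complex.Re a | a in A].
have Binf : has_inf B.
  split; first by exists (complex.Re a0), a0.
  by exists 0 => _ [a Aa <-]; have := A0 _ Aa; rewrite (AE a Aa) lecR.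
exists (inf B)%:C; split => [a Aa|e e0].
  rewrite (AE _ Aa) lecR; apply: ge_inf; first by case: Binf.
  by exists a.
have eE : e = (complex.Re e)%:C by move/ltW/ger0_Im: e0; case: e => ? ? /= ->.
have {}e0 : 0 < complex.Re e by rewrite -ltcR -eE.
have [_ [a Aa <-] ae] := inf_adherent e0 Binf.
by exists a => //; rewrite (AE a Aa) eE -rmorphD ltcR.
Qed.

Lemma Riesz (f : H -> R[i]) :
  (forall a x y, f (a *: x + y) = a * f x + f y) ->
  (exists M, forall x, `|f x| <= M * `|x|) ->
  exists z, forall x, f x = inner x z.
Proof.
move=> flin [M fM].
have f0 : f 0 = 0.
  by have := flin (-1) 0 0; rewrite scaler0 addr0 mulN1r addNr.
have fZ a x : f (a *: x) = a * f x by rewrite -[a *: x]addr0 flin f0 addr0.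
have fD x y : f (x + y) = f x + f y by rewrite -[x]scale1r flin mul1r scale1r.
have fB x y : f (x - y) = f x - f y by rewrite -scaleN1r fD fZ mulN1r.
have [[u fu]|nf] := pselect (exists u, f u != 0); last first.
  exists 0 => x; rewrite linear0r; apply/eqP/negP => /negP fx.
  by apply: nf; exists x.
have M0 : 0 <= M.
  have u0 : 0 < `|u|.
    by rewrite normr_gt0; apply: contraNneq fu => ->; rewrite f0.
  by rewrite -(pmulr_lge0 _ u0) (le_trans _ (fM u)).
pose A := [set `|x| ^+ 2 | x in [set x | f x = 1]].
have [d [dle dapp]] : exists d, (forall a, A a -> d <= a) /\
            (forall e, 0 < e -> exists2 a, A a & a < d + e).
  apply: infC; last by move=> _ [x _ <-]; rewrite exprn_ge0.
  by exists (`|(f u)^-1 *: u| ^+ 2), ((f u)^-1 *: u); rewrite //= fZ mulVf.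
pose G e := [set x | f x = 1 /\ `|x| ^+ 2 < d + e].
have Gne e : 0 < e -> G e !=set0.
  by move=> /dapp[_ [x fx <-] xe]; exists x.
have Gclose e x y : G e x -> G e y -> `|x - y| ^+ 2 < e *+ 4.
  move=> [fx xe] [fy ye].
  have : d *+ 4 <= `|x + y| ^+ 2.
    have : d <= `|2^-1 *: (x + y)| ^+ 2.
      apply: dle; exists (2^-1 *: (x + y)) => //=.
      by rewrite fZ fD fx fy mulVf// pnatr_eq0.
    rewrite normrZ exprMn normfV ger0_norm// exprVn -natrX.
    by rewrite ler_pdivlMl ?ltr0n// mulr_natl.
  move=> dxy; rewrite parallelogram ltrBlDr.
  apply: (@lt_le_trans _ _ (e *+ 4 + d *+ 4)); last by rewrite lerD2l.
  have -> : e *+ 4 + d *+ 4 = (d + e) *+ 2 + (d + e) *+ 2 by ring.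
  by rewrite ltrD// ltrMn2r.
pose F := filter_from [set e : R[i] | 0 < e] G.
have Gsub e1 e2 : e1 <= e2 -> G e1 `<=` G e2.
  by move=> e12 x [fx xe]; split => //; rewrite (lt_le_trans xe)// lerD2l.
have FF : ProperFilter F.
  apply: filter_from_proper => //; apply: filter_from_filter.
    by exists 1 => /=.
  move=> e1 e2 /= e10 e20.
  have e12 : e1 >=< e2 by apply: real_comparable; rewrite gtr0_real.
  case/orP: e12 => e12.
    by exists e1 => //= x xe; split => //; exact: (Gsub _ _ e12).
  by exists e2 => //= x xe; split => //; exact: (Gsub _ _ e12).
have /cvg_ex[/= z Fz] : cvg F.
  apply: cauchy_cvg; apply: cauchy_exP => e e0.
  have e40 : 0 < e ^+ 2 / 4 by rewrite divr_gt0// exprn_gt0.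
  have [x xe] := Gne _ e40.
  exists x, (e ^+ 2 / 4) => //= y ye.
  rewrite -ball_normE /= -(@ltr_pXn2r _ 2) ?nnegrE// ?ltW//.
  have <- : e ^+ 2 / 4 *+ 4 = e ^+ 2 by field.
  exact: Gclose.
have near e e' : 0 < e -> 0 < e' -> exists2 y, G e' y & `|z - y| < e.
  move=> e0 e'0.
  have Fb : F (ball z e) by apply: Fz; exact: nbhsx_ballx.
  have FG : F (G e') by exists e'.
  by have [y []] := filter_ex (filterI FG Fb); rewrite -ball_normE; exists y.
have eq0 (a b : R[i]) : 0 <= b -> (forall e, 0 < e -> `|a| <= e * b) -> a = 0.
  move=> b0 ab; apply/eqP; rewrite -normr_eq0; apply/negPn/negP => a0.
  have a1 : 0 < `|a| by rewrite lt_def a0 normr_ge0.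
  have b1 : 0 < b + 1 by rewrite ltr_wpDl.
  have q0 := divr_gt0 a1 b1.
  have : `|a| / (b + 1) * b < `|a|.
    by rewrite mulrAC ltr_pdivrMr// ltr_pM2l// ltrDl.
  by move=> /(le_lt_trans (ab _ q0)); rewrite ltxx.
have fz : f z = 1.
  apply/eqP; rewrite -subr_eq0; apply/eqP; apply: (eq0 _ M) => // e e0.
  have [y [fy _] zy] := near _ _ e0 e0.
  rewrite -fy -fB (le_trans (fM _))// mulrC ler_wpM2r// ltW//.
have orth k : f k = 0 -> inner k z = 0.
  move=> fk; apply: (eq0 _ (`|k| *+ 2)); first by rewrite mulrn_wge0.
  have [->|k0] := eqVneq k 0.
    by move=> e /ltW e0; rewrite linear0l normr0 mulr_ge0 ?mulrn_wge0.
  have kk0 : 0 < `|k| by rewrite normr_gt0.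
  have kN0 : `|k| != 0 by rewrite normr_eq0.
  have Gk e y : 0 < e -> G e y -> `|inner y k| ^+ 2 <= e * `|k| ^+ 2.
    move=> e0 [fy ye].
    pose t := inner y k / `|k| ^+ 2.
    have : d <= `|y - t *: k| ^+ 2.
      by apply: dle; exists (y - t *: k); rewrite //= fB fZ fk mulr0 subr0.
    rewrite -!inner_norm dnormB dnormZ linearZr_LR /= !inner_norm.
    have tE : t^* * inner y k = `|inner y k| ^+ 2 / `|k| ^+ 2.
      have kr : (`|k| ^- 2)^* = `|k| ^- 2 by rewrite geC0_conj// invr_ge0 exprn_ge0.
      rewrite /t rmorphM /= kr.
      by rewrite normCK mulrAC [_^* * _]mulrC.
    have tr : (t^* * inner y k)^* = t^* * inner y k.
      by rewrite tE geC0_conj// divr_ge0// exprn_ge0.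
    have -> : `|t| ^+ 2 * `|k| ^+ 2 = t^* * inner y k.
      rewrite tE /t normrM exprMn normfV normrX normr_id.
      by rewrite -mulrA; congr (_ * _); rewrite expr2 -mulrA mulVf ?mulr1// expf_neq0.
    rewrite tr opprD addrA addrK tE => dy.
    rewrite -ler_pdivrMr ?exprn_gt0//.
    rewrite -(lerD2l d) -lerBrDr (le_trans dy)// lerD2r.
    exact: ltW.
  move=> e e0.
  have ee0 : 0 < e ^+ 2 by rewrite exprn_gt0.
  have [y /(Gk _ _ ee0) yk zy] := near _ _ e0 ee0.
  rewrite dot_sym norm_conjC -[z](subrK y) linearDl /=.
  rewrite (le_trans (ler_normD _ _))// mulr2n mulrDr lerD//.
    by rewrite (le_trans (inner_CauchySchwarz _ _))// ler_wpM2r// ltW.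
  have e0' := ltW e0.
  by rewrite -(@ler_pXn2r _ 2) ?nnegrE ?mulr_ge0// exprMn.
have z0 : `|z| ^+ 2 != 0.
  rewrite expf_neq0// normr_eq0; apply/eqP => z0.
  by move: fz; rewrite z0 f0 => /eqP; rewrite eq_sym oner_eq0.
exists ((`|z| ^+ 2)^-1 *: z) => x.
have : inner (x - f x *: z) z = 0 by apply: orth; rewrite fB fZ fz mulr1 subrr.
rewrite linearBl /= linearZl_LR /= inner_norm => /eqP; rewrite subr_eq0 => /eqP xz.
rewrite linearZr_LR /= xz geC0_conj ?invr_ge0 ?exprn_ge0//.
by rewrite mulrCA mulVf// mulr1.
Qed.

End Riesz.

Record bounded_op (R : realType) (H K : hilbertType R) := BoundedOp {
  op_fun :> H -> K ;
  op_linear : linear op_fun ;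
  op_bounded : exists M : R[i], forall x, `|op_fun x| <= M * `|x|
}.

HB.instance Definition _ (R : realType) (H K : hilbertType R)
    (T : bounded_op H K) :=
  GRing.isLinear.Build R[i] H K *:%R (op_fun T) (op_linear T).

Section BoundedOperators.
Variable R : realType.
Implicit Types H K L : hilbertType R.

Lemma bounded_op_eq H K (A B : bounded_op H K) : A =1 B -> A = B.
Proof.
case: A B => [f lf bf] [g lg bg] /= /funext fg; rewrite -{}fg in lg bg *.
by congr BoundedOp; exact: Prop_irrelevance.
Qed.

Lemma op_bounded_gt0 H K (T : bounded_op H K) :
  exists2 M : R[i], 0 < M & forall x, `|T x| <= M * `|x|.
Proof.
have [M TM] := op_bounded T.
have [[x x0]|nx] := pselect (exists x : H, x != 0); last first.
  exists 1 => // x; have [->|x0] := eqVneq x 0; last by case: nx; exists x.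
  by rewrite linear0 !normr0 mulr0.
have M0 : 0 <= M.
  have x1 : 0 < `|x| by rewrite normr_gt0.
  by rewrite -(pmulr_lge0 _ x1) (le_trans _ (TM x)).
exists (M + 1) => [|y]; first by rewrite ltr_wpDl.
by rewrite (le_trans (TM y))// ler_wpM2r// lerDl.
Qed.

Let zero_linear H K : linear (fun _ : H => 0 : K).
Proof. by move=> a x y; rewrite scaler0 addr0. Qed.

Let zero_bounded H K : exists M : R[i], forall x : H, `|0 : K| <= M * `|x|.
Proof. by exists 0 => x; rewrite normr0 mul0r. Qed.

Definition op_zero H K : bounded_op H K :=
  BoundedOp (@zero_linear H K) (@zero_bounded H K).

Let id_linear H : linear (@idfun H).
Proof. by []. Qed.

Let id_bounded H : exists M : R[i], forall x : H, `|idfun x| <= M * `|x|.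
Proof. by exists 1 => x; rewrite mul1r. Qed.

Definition op_id H : bounded_op H H :=
  BoundedOp (@id_linear H) (@id_bounded H).

Section Composition.
Variables (H K L : hilbertType R) (A : bounded_op K L) (B : bounded_op H K).

Let comp_linear : linear (A \o B).
Proof. by move=> a x y /=; rewrite !linearP. Qed.

Let comp_bounded : exists M : R[i], forall x, `|(A \o B) x| <= M * `|x|.
Proof.
have [M M0 AM] := op_bounded_gt0 A; have [N N0 BN] := op_bounded_gt0 B.
exists (M * N) => x; rewrite (le_trans (AM _))// -mulrA.
by rewrite ler_wpM2l// ltW.
Qed.

Definition op_comp : bounded_op H L := BoundedOp comp_linear comp_bounded.

End Composition.

Section DirectSum.
Variables (K L : hilbertType R) (A : bounded_op K K) (B : bounded_op L L).

Let sum_fun (u : hsum K L) : hsum K L := (A u.1, B u.2).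

Let sum_linear : linear sum_fun.
Proof.
by move=> a u v; rewrite /sum_fun /= !linearP.
Qed.

Let sum_bounded : exists M : R[i], forall u, `|sum_fun u| <= M * `|u|.
Proof.
have [M M0 AM] := op_bounded_gt0 A; have [N N0 BN] := op_bounded_gt0 B.
exists (M + N) => u; rewrite (le_trans (hsum_normD _))//= mulrDl lerD//.
  by rewrite (le_trans (AM _))// ler_wpM2l ?hsum_norm1// ltW.
by rewrite (le_trans (BN _))// ler_wpM2l ?hsum_norm2// ltW.
Qed.

Definition op_sum : bounded_op (hsum K L) (hsum K L) :=
  BoundedOp sum_linear sum_bounded.

End DirectSum.

Lemma adjoint_exists H K (T : bounded_op H K) :
  exists S : bounded_op K H, forall x y, inner (T x) y = inner x (S y).
Proof.
have [M M0 TM] := op_bounded_gt0 T.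
have /choice[S SP] : forall y, exists z, forall x, inner (T x) y = inner x z.
  move=> y; apply: Riesz => [a u v|].
    by rewrite linearP linearDl linearZl_LR.
  exists (M * `|y|) => x; rewrite (le_trans (inner_CauchySchwarz _ _))//.
  by rewrite mulrAC ler_wpM2r.
have Slin : linear S.
  move=> a u v; apply: inner_inj => x.
  by rewrite -SP !linearDr /= !linearZr_LR /= !SP.
have Sbnd : exists N : R[i], forall y, `|S y| <= N * `|y|.
  exists M => y; have [->|Sy0] := eqVneq (S y) 0.
    by rewrite normr0 mulr_ge0// ltW.
  have n0 : 0 < `|S y| by rewrite normr_gt0.
  rewrite -(ler_pM2l n0) -expr2 -inner_norm -SP.
  rewrite -[leLHS]ger0_norm; last by rewrite SP.
  rewrite (le_trans (inner_CauchySchwarz _ _))// mulrA ler_wpM2r//.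
  by rewrite [leRHS]mulrC.
by exists (BoundedOp Slin Sbnd).
Qed.

Definition adjoint H K (T : bounded_op H K) : bounded_op K H :=
  sval (cid (adjoint_exists T)).

Lemma adjointP H K (T : bounded_op H K) x y :
  inner (T x) y = inner x (adjoint T y).
Proof. exact: (svalP (cid (adjoint_exists T))). Qed.

Lemma adjoint_unique H K (T : bounded_op H K) (S : bounded_op K H) :
  (forall x y, inner (T x) y = inner x (S y)) -> S = adjoint T.
Proof.
move=> TS; apply: bounded_op_eq => y; apply: inner_inj => x.
by rewrite -TS adjointP.
Qed.

Definition normal_op H (T : bounded_op H H) :=
  op_comp T (adjoint T) = op_comp (adjoint T) T.

Definition selfadjoint_op H (T : bounded_op H H) := adjoint T = T.

Definition unitary_op H K (U : bounded_op H K) :=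
  op_comp (adjoint U) U = op_id H /\ op_comp U (adjoint U) = op_id K.

Definition unitarily_equivalent H K (A : bounded_op H H) (B : bounded_op K K) :=
  exists2 W : bounded_op H K,
    unitary_op W & op_comp (op_comp W A) (adjoint W) = B.

Definition op_ker H K (T : bounded_op H K) : set H := [set x | T x = 0].

End BoundedOperators.

Section Semigroups.
Variables (R : realType) (H : hilbertType R).
Implicit Types (S J G : set (bounded_op H H)) (A B T X : bounded_op H H).

Definition semigroup S := forall A B, S A -> S B -> S (op_comp A B).

Inductive generated_semigroup G : set (bounded_op H H) :=
| gen_semigroup_incl A : G A -> generated_semigroup G A
| gen_semigroup_comp A B : generated_semigroup G A -> generated_semigroup G B ->
    generated_semigroup G (op_comp A B).

Definition semigroup_adj T := generated_semigroup [set T; adjoint T].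

Definition semigroup_ideal S J :=
  J `<=` S /\
  forall A X, J A -> S X -> J (op_comp X A) /\ J (op_comp A X).

Definition SI_semigroup S :=
  semigroup S /\
  forall J, semigroup_ideal S J -> [set adjoint A | A in J] `<=` J.

Definition simple_semigroup S :=
  semigroup S /\
  forall J, semigroup_ideal S J -> (exists2 A, J A & A <> op_zero H H) -> J = S.

End Semigroups.

(* Main.v *)
Require Import Defs.
From HB Require Import structures.
From mathcomp Require Import all_boot all_order all_algebra.
From mathcomp Require Import complex.
From mathcomp Require Import boolp classical_sets reals topology normedtype.

(** Since [T] is normal, the semigroup consists of the words [T^m T*^n], and the
    principal ideal of [T] of the words with [m >= 1].  Both the SI property and
    simplicity force [T*] into that ideal: [T* = T^m T*^n] with [m >= 1], and
    [m + n >= 2] because [T] is not selfadjoint.  Combined with its adjoint, this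
    identity says that the positive operator [P = T T*] satisfies
    [P^j T = T] for some [j >= 1], whence [P T = T], with no appeal to the
    spectral theorem.  So [P] is a projection commuting with [T], and [T] is
    unitary on its range and zero on its kernel.  Conversely, if [T T* T = T]
    the semigroup is a group with identity [P] and inverse [A |-> A*], so that
    every nonempty ideal is everything. *)

Set Implicit Arguments.
Unset Strict Implicit.
Unset Printing Implicit Defensive.

Import Order.TTheory GRing.Theory Num.Theory.
Import numFieldNormedType.Exports.

Local Open Scope classical_set_scope.
Local Open Scope ring_scope.

(** * Kernels of bounded operators as Hilbert spaces *)

Section KernelHilbert.
Variables (R : realType) (H : hilbertType R) (A : bounded_op H H).

Definition ker_pred : {pred H} := [pred x | A x == 0].

Let ker_pred_submod_closed : submod_closed ker_pred.
Proof.
split=> [|a u v]; rewrite !inE ?linear0// => /eqP Au /eqP Av.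
by rewrite linearP /= Au Av scaler0 addr0.
Qed.

HB.instance Definition _ :=
  GRing.isSubmodClosed.Build R[i] H ker_pred ker_pred_submod_closed.

(** One construction serves both summands of the decomposition: the range of a projection [P] is the
    kernel of [1 - P]. *)
Record ker_space := KerSpace { ker_val :> H ; _ : ker_val \in ker_pred }.

HB.instance Definition _ := [isSub for ker_val].
HB.instance Definition _ := [Choice of ker_space by <:].
HB.instance Definition _ := [SubChoice_isSubLmodule of ker_space by <:].

Lemma ker_valP (u : ker_space) : A (val u) = 0.
Proof. by have := valP u; rewrite inE => /eqP. Qed.

Definition ker_inner (u v : ker_space) : R[i] := inner (val u) (val v).

Let ker_bilinear : bilinear_for *%R (@Num.conj R[i] \; *%R) ker_inner.
Proof.
split=> [w a u v|w a u v]; rewrite /ker_inner.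
  by rewrite linearP linearDl /= linearZl_LR.
by rewrite linearP.
Qed.

Let ker_hermitian (u v : ker_space) :
  ker_inner u v = (-1) ^+ false * (ker_inner v u)^*.
Proof. by rewrite /ker_inner expr0 mul1r -dot_sym. Qed.

Let ker_gt0 (u : ker_space) : u != 0 -> 0 < ker_inner u u.
Proof.
move=> u0; rewrite dnorm_gt0; apply: contra u0 => /eqP u0.
by apply/eqP/val_inj; rewrite u0 linear0.
Qed.

HB.instance Definition _ := @bilinear_isBilinear.Build R[i] ker_space ker_space
  R[i] *%R (@Num.conj R[i] \; *%R) ker_inner ker_bilinear.
HB.instance Definition _ := @isHermitianSesquilinear.Build R[i] ker_space false
  (@Num.conj R[i]) ker_inner ker_hermitian.
HB.instance Definition _ :=
  @isDotProduct.Build R[i] ker_space ker_inner ker_gt0.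

HB.instance Definition _ := @Lmodule_hasInner.Build R ker_space ker_inner.

Lemma ker_normE (u : ker_space) : `|u| = `|val u|.
Proof. by apply: (@pexpIrn _ 2); rewrite ?nnegrE// -!inner_norm. Qed.

Let ker_complete (F : set_system ker_space) :
  ProperFilter F -> cauchy F -> cvg F.
Proof.
move=> FF /cauchy_ballP Fc.
have /cvg_ex[/= x Fx] : cvg ((val : ker_space -> H) @ F).
  apply: cauchy_cvg; apply/cauchy_ballP => e e0.
  have := Fc e e0; rewrite /= => -[[B C]] /= [FB FC] BC.
  exists ([set val x | x in B], [set val x | x in C]) => /=.
    split; rewrite /nbhs/=.
      by apply: filterS FB => u Bu; exists u.
    by apply: filterS FC => u Cu; exists u.
  move=> [_ _] /= [[u Bu <-] [v Cv <-]].
  have := BC (u, v) (conj Bu Cv).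
  by rewrite -!ball_normE /= ker_normE linearB.
move/cvgrPdist_lt: Fx => Fx.
(* The limit stays in the kernel: otherwise some [u] in the kernel lies within [|A x| / M] of [x],
   and [|A x| = |A (x - u)| <= M |x - u| < |A x|]. *)
have Ax : x \in ker_pred.
  rewrite inE; apply/negPn/negP => Ax0.
  have [M M0 AM] := op_bounded_gt0 A.
  have Ax1 : 0 < `|A x| / M by rewrite divr_gt0// normr_gt0.
  have [u] := filter_ex (Fx _ Ax1).
  rewrite ltr_pdivlMr// mulrC => /(le_lt_trans (AM _)).
  by rewrite linearB /= ker_valP subr0 ltxx.
apply/cvg_ex; exists (KerSpace Ax); apply/cvgrPdist_lt => e /Fx.
by apply: filterS => u; rewrite ker_normE linearB.
Qed.

HB.instance Definition _ := Uniform_isComplete.Build ker_space ker_complete.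

Lemma ker_innerE (u v : ker_space) : inner u v = inner (val u) (val v).
Proof. by []. Qed.

Section Lift.
Variables (G : hilbertType R) (f : bounded_op G H).
Hypothesis Af : forall x, A (f x) = 0.

Let ker_lift_subproof x : f x \in ker_pred.
Proof. by rewrite inE Af. Qed.

Let ker_lift_fun x := KerSpace (ker_lift_subproof x).

Let ker_lift_linear : linear ker_lift_fun.
Proof. by move=> a x y; apply: val_inj; rewrite /= !linearP. Qed.

Let ker_lift_bounded : exists M : R[i], forall x, `|ker_lift_fun x| <= M * `|x|.
Proof.
have [M _ fM] := op_bounded_gt0 f.
by exists M => x; rewrite ker_normE fM.
Qed.

Definition ker_lift : bounded_op G ker_space :=
  BoundedOp ker_lift_linear ker_lift_bounded.

End Lift.

Let ker_incl_linear : linear (val : ker_space -> H).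
Proof. by move=> a x y; rewrite linearP. Qed.

Let ker_incl_bounded : exists M : R[i], forall x : ker_space, `|val x| <= M * `|x|.
Proof. by exists 1 => x; rewrite mul1r ker_normE. Qed.

Definition ker_incl : bounded_op ker_space H :=
  BoundedOp ker_incl_linear ker_incl_bounded.

End KernelHilbert.

(** * Calculus of adjoints, and partial isometries *)

Section OperatorAlgebra.
Variable R : realType.
Implicit Types H K L : hilbertType R.

Section Difference.
Variables (H K : hilbertType R) (A B : bounded_op H K).

Let sub_linear : linear (fun x => A x - B x).
Proof. by move=> a x y; rewrite !linearP scalerDr addrACA. Qed.

Let sub_bounded : exists M : R[i], forall x, `|A x - B x| <= M * `|x|.
Proof.
have [M _ AM] := op_bounded_gt0 A; have [N _ BN] := op_bounded_gt0 B.
by exists (M + N) => x; rewrite (le_trans (ler_normB _ _))// mulrDl lerD.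
Qed.

Definition op_sub : bounded_op H K := BoundedOp sub_linear sub_bounded.

End Difference.

Section Pairing.
Variables (H K L : hilbertType R) (A : bounded_op H K) (B : bounded_op H L).

Let pair_fun (x : H) : hsum K L := (A x, B x).

Let pair_linear : linear pair_fun.
Proof. by move=> a x y; rewrite /pair_fun !linearP. Qed.

Let pair_bounded : exists M : R[i], forall x, `|pair_fun x| <= M * `|x|.
Proof.
have [M _ AM] := op_bounded_gt0 A; have [N _ BN] := op_bounded_gt0 B.
by exists (M + N) => x; rewrite (le_trans (hsum_normD _))//= mulrDl lerD.
Qed.

Definition op_pair : bounded_op H (hsum K L) :=
  BoundedOp pair_linear pair_bounded.

End Pairing.

Lemma hsum_innerE K L (u v : hsum K L) :
  inner u v = inner u.1 v.1 + inner u.2 v.2.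
Proof. by []. Qed.

Lemma adjointPr H K (T : bounded_op H K) x y :
  inner x (T y) = inner (adjoint T x) y.
Proof. by rewrite dot_sym (adjointP T) -dot_sym. Qed.

Lemma adjointK H K (T : bounded_op H K) : adjoint (adjoint T) = T.
Proof. by apply/esym/adjoint_unique => x y; rewrite adjointPr. Qed.

Lemma adjoint_comp H K L (A : bounded_op K L) (B : bounded_op H K) :
  adjoint (op_comp A B) = op_comp (adjoint B) (adjoint A).
Proof. by apply/esym/adjoint_unique => x y /=; rewrite !adjointP. Qed.

Lemma adjoint_zero H K : adjoint (op_zero H K) = op_zero K H.
Proof.
by apply/esym/adjoint_unique => x y /=; rewrite linear0l linear0r.
Qed.

Lemma adjoint_sum K L (A : bounded_op K K) (B : bounded_op L L) :
  adjoint (op_sum A B) = op_sum (adjoint A) (adjoint B).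
Proof.
by apply/esym/adjoint_unique => x y; rewrite !hsum_innerE /= !adjointP.
Qed.

(** The algebraic form [T T* T = T], stated pointwise for rewriting. *)
Definition partial_isometry H K (T : bounded_op H K) :=
  forall x, T (adjoint T (T x)) = T x.

Lemma unitary_partial_isometry H K (U : bounded_op H K) :
  unitary_op U -> partial_isometry U.
Proof. by move=> [UU _] x; have /= -> := congr1 (fun A => op_fun A x) UU. Qed.

Lemma partial_isometry_sum0 K L (U : bounded_op K K) :
  partial_isometry U -> partial_isometry (op_sum U (op_zero L L)).
Proof.
by move=> pU u; rewrite adjoint_sum adjoint_zero /= pU.
Qed.

(** With [B = W A W*], the identity for [B] at [W x] reads [W A A* A x = W A x], and [W*] cancels
    [W]. *)
Lemma partial_isometry_equiv H K (A : bounded_op H H) (B : bounded_op K K) :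
  unitarily_equivalent A B -> partial_isometry B -> partial_isometry A.
Proof.
move=> [W [WW _] <-] pB x.
have {}WW y : adjoint W (W y) = y by exact: (congr1 (fun A => op_fun A y) WW).
have := pB (W x); rewrite !adjoint_comp adjointK /= !WW.
by move/(congr1 (adjoint W)); rewrite !WW.
Qed.

End OperatorAlgebra.

(** * Splitting a normal partial isometry into a unitary and zero *)

Section PartialIsometryDecomposition.
Variables (R : realType) (H : hilbertType R) (T : bounded_op H H).
Hypotheses (normalT : normal_op T) (pT : partial_isometry T).

Let normalTE x : T (adjoint T x) = adjoint T (T x).
Proof. exact: (congr1 (fun A => op_fun A x) normalT). Qed.

(** [P = T T* = T* T] is the orthogonal projection onto the range of [T], and [Q = 1 - P] the one
    onto its kernel. *)
Let P := op_comp T (adjoint T).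
Let Q := op_sub (op_id H) P.

Let TP x : T (P x) = T x. Proof. by rewrite /= normalTE pT. Qed.

Let PT' x : P (adjoint T x) = adjoint T x.
Proof.
apply: inner_inj => y; rewrite /= normalTE -!adjointP.
by rewrite adjointPr -adjointP pT.
Qed.

Let Padj x y : inner (P x) y = inner x (P y).
Proof. by rewrite /= adjointP [RHS]adjointPr. Qed.

Let QP x : Q (P x) = 0. Proof. by rewrite /= pT subrr. Qed.
Let QT x : Q (T x) = 0. Proof. by rewrite /= pT subrr. Qed.
Let QT' x : Q (adjoint T x) = 0.
Proof. by rewrite /= [T _]PT' subrr. Qed.
Let PQ x : P (Q x) = 0.
Proof. by rewrite /= !linearB /= pT subrr. Qed.

Let K : hilbertType R := ker_space Q.
Let L : hilbertType R := ker_space P.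

Let PK (u : K) : T (adjoint T (val u)) = val u.
Proof. by apply/esym/eqP; rewrite -subr_eq0; apply/eqP; exact: (ker_valP u). Qed.

Let PL (v : L) : T (adjoint T (val v)) = 0. Proof. exact: (ker_valP v). Qed.

Let TL (v : L) : T (val v) = 0.
Proof. by rewrite -TP (ker_valP v) linear0. Qed.

(** The restriction of [T] to the range of [P]. The restriction [U'] of [T*] is both its adjoint and
    its inverse, because [T T* = P] is the identity there. *)
Let U : bounded_op K K :=
  @ker_lift _ _ Q _ (op_comp T (ker_incl Q)) (fun x => QT (val x)).

Let U' : bounded_op K K :=
  @ker_lift _ _ Q _ (op_comp (adjoint T) (ker_incl Q)) (fun x => QT' (val x)).

(** The orthogonal splitting [x = P x + Q x]; its adjoint and inverse is addition of the two
    components. *)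
Let W : bounded_op H (hsum K L) :=
  op_pair (@ker_lift _ _ Q _ P QP) (@ker_lift _ _ P _ Q PQ).

Let adjU : adjoint U = U'.
Proof.
by apply/esym/adjoint_unique => x y; rewrite !ker_innerE /= adjointP.
Qed.

Let unitaryU : unitary_op U.
Proof.
rewrite /unitary_op adjU; split; apply: bounded_op_eq => x; apply: val_inj => /=.
  by rewrite -normalTE PK.
by rewrite PK.
Qed.

Let adjW (y : hsum K L) : adjoint W y = val y.1 + val y.2.
Proof.
apply: inner_inj => x; rewrite -adjointP hsum_innerE !ker_innerE.
rewrite [val (W x).1]/(P x) [val (W x).2]/(x - P x).
rewrite linearBl /= -!/(P _) !Padj.
by rewrite [P (val y.1)]PK [P (val y.2)]PL linear0r subr0 linearDr.
Qed.

Let unitaryW : unitary_op W.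
Proof.
split; apply: bounded_op_eq => x; rewrite [LHS]/= adjW.
  by rewrite /= addrC subrK.
case: x => u v; congr pair; apply: val_inj => /=.
  by rewrite !linearD /= PK PL addr0.
by rewrite !linearD /= PK PL oppr0 addr0 addrAC subrr add0r.
Qed.

Lemma partial_isometry_unitary_sum0 :
  exists (K L : hilbertType R) (U : bounded_op K K),
    unitary_op U /\ unitarily_equivalent T (op_sum U (op_zero L L)).
Proof.
exists K, L, U; split=> //; exists W => //.
apply: bounded_op_eq => -[u v]; rewrite [LHS]/= adjW linearD /= TL addr0.
by congr pair; apply: val_inj; rewrite /= pT ?subrr.
Qed.

End PartialIsometryDecomposition.

(** * Words in a normal operator and its adjoint *)

Section NormalSemigroup.
Variables (R : realType) (H : hilbertType R) (T : bounded_op H H).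
Hypothesis normalT : normal_op T.
Local Notation T' := (adjoint T).
Local Notation S := (semigroup_adj T).

Let normalTE x : T (T' x) = T' (T x).
Proof. exact: (congr1 (fun A => op_fun A x) normalT). Qed.

Let iterC m n x : iter m T' (iter n T x) = iter n T (iter m T' x).
Proof.
have T'C j y : T' (iter j T y) = iter j T (T' y).
  by elim: j => //= j IH; rewrite -normalTE IH.
by elim: m => //= m ->.
Qed.

Let adjoint_iter m x y : inner (iter m T x) y = inner x (iter m T' y).
Proof. by elim: m y => //= m IH y; rewrite adjointP IH -iterSr. Qed.

Let adjoint_iterr m x y : inner (iter m T' x) y = inner x (iter m T y).
Proof. by rewrite dot_sym -adjoint_iter -dot_sym. Qed.

Lemma semigroup_adj_semigroup : semigroup S.
Proof. by move=> A B; exact: gen_semigroup_comp. Qed.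

Lemma semigroup_adj_T : S T.
Proof. by apply: gen_semigroup_incl; left. Qed.

Lemma semigroup_adj_T' : S T'.
Proof. by apply: gen_semigroup_incl; right. Qed.

Lemma semigroup_adj_word A : S A ->
  exists m n, forall x, A x = iter m T (iter n T' x).
Proof.
elim=> [B [->|->]|B C _ [m [n Bmn]] _ [p [q Cpq]]].
- by exists 1, 0.
- by exists 0, 1.
- exists (m + p), (n + q) => x; rewrite /= Cpq Bmn iterC.
  by rewrite !iterD.
Qed.

(** The words with at least one letter [T], whence [m.+1]. An operator may be written as a word in
    several ways; one such form is enough. *)
Definition word_ideal := [set A | S A /\
  exists m n, forall x, A x = iter m.+1 T (iter n T' x)].

Lemma word_ideal_ideal : semigroup_ideal S word_ideal.
Proof.
split=> [A []//|A X [SA [m [n Amn]]] SX].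
have [p [q Xpq]] := semigroup_adj_word SX.
split; (split; first exact: gen_semigroup_comp).
  exists (p + m), (q + n) => x; rewrite [LHS]/= Xpq Amn iterC.
  by rewrite -addnS !iterD.
exists (m + p), (n + q) => x; rewrite [LHS]/= Amn Xpq iterC.
by rewrite -addSn !iterD.
Qed.

Lemma word_ideal_T : word_ideal T.
Proof. by split; [exact: semigroup_adj_T|exists 0, 0]. Qed.

Lemma word_ideal_adjoint_power : ~ selfadjoint_op T -> word_ideal T' ->
  exists k, forall x, T x = iter k.+2 T (iter k.+1 T' x).
Proof.
move=> nsa [_ [m [n T'mn]]].
(* This is the adjoint of [T* = T^(m+1) T*^n]. *)
have Tnm x : T x = iter n T (iter m.+1 T' x).
  apply/esym/inner_inj => y.
  by rewrite adjointPr T'mn adjoint_iter -adjoint_iterr -adjoint_iter.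
(* For [m = n = 0] the word would give [T* = T]. *)
have [k kmn] : exists k, (n + m = k.+1)%N.
  case: n m T'mn {Tnm} => [|n] [|m] T'mn; last 3 first.
  - by exists m.
  - by exists n; rewrite addn0.
  - by exists (n + m.+1)%N.
  by case: nsa; apply: bounded_op_eq.
exists k => x.
(* Replacing the innermost [T*] by its word gives [T = T^(n+m+1) T*^(m+n)]. *)
rewrite Tnm iterSr T'mn iterC -!iterD.
by rewrite addnS kmn [(m + n)%N]addnC kmn.
Qed.

(* With [P = T T'] and [z = T x] the hypothesis reads [P^k.+1 z = z], so
   [y = P z - z] is killed by [1 + P + ... + P^k]; pairing with [y] gives
   [|y|^2 = 0] because every power of [P] is positive. *)
Lemma power_partial_isometry k :
  (forall x, T x = iter k.+2 T (iter k.+1 T' x)) -> partial_isometry T.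
Proof.
move=> Tk x; pose P := op_comp T T'.
(* By normality [P^j = T^j T*^j], so that [inner (P^j y) y] is the squared norm of [T*^j y]. *)
have PE j y : iter j P y = iter j T (iter j T' y).
  elim: j => //= j ->.
  by rewrite -[T' (iter j T _)]/(iter 1 T' (iter j T _)) iterC.
have P_ge0 j y : 0 <= inner (iter j P y) y.
  by rewrite PE adjoint_iter.
have PB j u v : iter j P (u - v) = iter j P u - iter j P v.
  by elim: j => //= j ->; rewrite !linearB.
set z := T x; pose y := P z - z.
have zP : iter k.+1 P z = z.
  by rewrite PE /z -[T x]/(iter 1 T x) iterC -iterD addn1 -Tk.
have sum0 : \sum_(0 <= i < k.+1) iter i P y = 0.
  under eq_bigr do rewrite PB -iterSr.
  by rewrite telescope_sumr// zP subrr.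
suff y0 : y = 0 by apply/eqP; rewrite -subr_eq0; apply/eqP.
apply/eqP; rewrite -(@dnorm_eq0 _ _ inner) eq_le; apply/andP; split=> //.
have : inner (\sum_(0 <= i < k.+1) iter i P y) y = 0 by rewrite sum0 linear0l.
rewrite linear_sumlz big_nat_recl// => s0.
by rewrite -[leRHS]s0 lerDl sumr_ge0// => i _; exact: P_ge0.
Qed.

(** * The group structure when [T T* T = T] *)

Hypothesis pT : partial_isometry T.
Local Notation E := (op_comp T T').

Let pT' x : T' (T (T' x)) = T' x.
Proof.
apply: inner_inj => y.
by rewrite -!adjointP adjointPr -adjointP pT.
Qed.

(** Induction on words. The clause [E A* = A*] carries the product step:
    [(B C)(B C)* = B E B* = B B* = E]. *)
Lemma semigroup_adj_inverse A : S A ->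
  [/\ S (adjoint A), op_comp A (adjoint A) = E, op_comp E A = A
    & op_comp E (adjoint A) = adjoint A].
Proof.
elim=> [B [->|->]|B C _ [SB BB EB EB'] _ [SC CC EC EC']].
- split; rewrite //; first exact: semigroup_adj_T'.
    by apply: bounded_op_eq => x /=.
  by apply: bounded_op_eq => x /=; rewrite normalTE pT'.
- rewrite adjointK; split; rewrite //; first exact: semigroup_adj_T.
    by apply: bounded_op_eq => x /=; rewrite normalTE pT'.
  by apply: bounded_op_eq => x /=.
have compA (A1 A2 A3 : bounded_op H H) :
  op_comp A1 (op_comp A2 A3) = op_comp (op_comp A1 A2) A3 by exact: bounded_op_eq.
rewrite adjoint_comp; split.
- exact: gen_semigroup_comp.
- by rewrite -compA (compA C) CC EB'.
- by rewrite compA EB.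
- by rewrite compA EC'.
Qed.

(** The ideal contains [A A* = E], hence [E X = X] for every [X] in the semigroup. *)
Lemma nonempty_ideal_full J A : semigroup_ideal S J -> J A -> J = S.
Proof.
move=> [JS JI] JA; apply/seteqP; split=> // X SX.
have [SA' AA' _ _] := semigroup_adj_inverse (JS _ JA).
have [_ _ <- _] := semigroup_adj_inverse SX.
by have [_] := JI _ _ JA SA'; rewrite AA' => /JI /(_ SX)[].
Qed.

Lemma partial_isometry_simple : simple_semigroup S.
Proof.
split=> [|J IJ [A JA _]]; first exact: semigroup_adj_semigroup.
exact: nonempty_ideal_full JA.
Qed.

Lemma partial_isometry_SI : SI_semigroup S.
Proof.
split=> [|J IJ _ [A JA <-]]; first exact: semigroup_adj_semigroup.
have [] := semigroup_adj_inverse (proj1 IJ _ JA).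
by rewrite (nonempty_ideal_full IJ JA).
Qed.

End NormalSemigroup.

Theorem theorem2p1 (R : realType) (H : hilbertType R) (T : bounded_op H H)
    (normalT : normal_op T) (notsaT : ~ selfadjoint_op T) :
  let is_SI := SI_semigroup (semigroup_adj T) in
  let is_U0 :=
    (exists (K L : hilbertType R) (U : bounded_op K K),
      unitary_op U /\ unitarily_equivalent T (op_sum U (op_zero L L)))
    \/ (op_ker T = [set 0] /\
        exists (K : hilbertType R) (U : bounded_op K K),
          unitary_op U /\ unitarily_equivalent T U) in
  let is_simple := simple_semigroup (semigroup_adj T) in
  (is_SI <-> is_U0) /\ (is_U0 <-> is_simple).
Proof.
move=> is_SI is_U0 is_simple.
have U0_pT : is_U0 -> partial_isometry T.
  move=> [[K [L [U [uU TU]]]]|[_ [K [U [uU TU]]]]];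
    apply: partial_isometry_equiv TU _; last exact: unitary_partial_isometry.
  exact/partial_isometry_sum0/unitary_partial_isometry.
(* The form with a zero summand is always the one produced; [L] is the zero space when [T] is
   injective. *)
have T'_U0 : word_ideal T (adjoint T) -> is_U0.
  move=> /(word_ideal_adjoint_power normalT notsaT)[k].
  by move=> /(power_partial_isometry normalT) pT; left;
     exact: partial_isometry_unitary_sum0.
have IT := word_ideal_ideal normalT.
split; split.
- by move=> [_ /(_ _ IT) SI]; apply/T'_U0/SI; exists T; first exact: word_ideal_T.
- by move=> /U0_pT; exact: partial_isometry_SI.
- by move=> /U0_pT; exact: partial_isometry_simple.
(* The ideal contains [T], which is nonzero because the zero operator is selfadjoint; so it is
   everything and contains [T*]. *)
move=> [_ /(_ _ IT) simpleT]; apply: T'_U0; rewrite simpleT.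
  exact: semigroup_adj_T'.
exists T; first exact: word_ideal_T.
by move=> T0; apply: notsaT; rewrite T0 /selfadjoint_op adjoint_zero.
Qed.
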